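(* For $\eta\in\{0,\dots,n\}^{\Lambda_L}$ let $$E(\eta):=-\sum_{k=L^-}^{L^+}\sum_{l=L^-}^{k-1}\operatorname{sgn}(\eta_k-\eta_l),\qquad \pi(\eta):=q^{-E(\eta)} .$$ Then the following holds. (i) $\pi$ is a reversible (unnormalized) measure for the $n$-priority ASEP on $\Lambda_L$. (ii) For particle numbers $\vec N=(N^1,\dots,N^n)$ with integers $N^\alpha\ge 0$ and $N^0:=L-\sum_{\alpha=1}^nN^\alpha\ge 0$, the canonical measure $$\pi^c_{\vec N}(\eta)=\frac{\pi(\eta)\,\mathcal P_{\vec N}(\eta)}{C_L(\vec N)},\qquad C_L(\vec N)=\frac{[L]_q!}{\prod_{\alpha=0}^n[N^\alpha]_q!},$$ is the unique invariant (probability) measure of the process on the set $\{\eta:\ N^\alpha(\eta)=N^\alpha \text{ for } 1\le\alpha\le n\}$. (iii) For chemical potentials $\vec\mu=(\mu_1,\dots,\mu_n)\in\mathbb R^n$ the grand-canonical measures $$\pi^g_{\vec\mu}(\eta)=\frac{e^{\sum_{\alpha=1}^n\mu_\alpha N^\alpha(\eta)}}{Z_L(\vec\mu)}\,\pi(\eta),\qquad Z_L(\vec\mu)=\sum_{\vec N}e^{\sum_{\alpha=1}^n\mu_\alpha N^\alpha}C_L(\vec N)$$ (the sum running over all $\vec N$ with nonnegative integer entries and $\sum_{\alpha=1}^nN^\alpha\le L$; $Z_L$ is the homogeneous multivariate Rogers–Szegő polynomial) are invariant (probability) measures of the process.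
   Context: Fix an integer $n\ge1$, reals $w>0$ and $q\ge1$, and integers $L^-,L^+$ with $L:=L^+-L^-+1\ge2$; put $\Lambda_L=\{L^-,\dots,L^+\}$. Configurations are $\eta=(\eta_k)_{k\in\Lambda_L}\in\{0,\dots,n\}^{\Lambda_L}$. Let $\eta^{kk+1}$ be $\eta$ with the values at $k$ and $k+1$ interchanged, and $\operatorname{sgn}(x)\in\{1,0,-1\}$ the sign function with $\operatorname{sgn}(0)=0$. The $n$-priority ASEP on $\Lambda_L$ is the continuous-time Markov chain on $\{0,\dots,n\}^{\Lambda_L}$ with generator $$\mathcal Lf(\eta)=\sum_{k=L^-}^{L^+-1}w\big(q^{\operatorname{sgn}(\eta_k-\eta_{k+1})}-\delta_{\eta_k,\eta_{k+1}}\big)\,[f(\eta^{kk+1})-f(\eta)].$$ The particle numbers are $N^\alpha(\eta)=\sum_{k}\delta_{\eta_k,\alpha}$, and $\mathcal P_{\vec N}(\eta)=\prod_{\alpha=1}^n\delta_{N^\alpha(\eta),N^\alpha}$. The symmetric $q$-number is $[c]_q=(q^c-q^{-c})/(q-q^{-1})$ (with $[c]_1=c$), $[m]_q!=\prod_{j=1}^m[j]_q$, $[0]_q!=1$. Reversible means that detailed balance holds. *)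

(* Defs.v *)
From HB Require Import structures.
From mathcomp Require Import all_boot all_order all_algebra.
From mathcomp Require Import all_classical all_reals all_analysis.

Set Implicit Arguments.
Unset Strict Implicit.
Unset Printing Implicit Defensive.

Import Order.TTheory GRing.Theory Num.Theory.
Import numFieldNormedType.Exports.
Local Open Scope ring_scope.

(** * Continuous-time Markov chains on a finite state space [S]

A generator acts on observables [f : S -> R]; a measure on [S] is its mass
function [S -> R]. *)

(* e^{tG} f (x) = sum_j t^j / j! (G^j f)(x) = E_x[f(X_t)].  The series converges
   for every linear [G] because [S] is finite. *)
Definition semigroup (R : realType) (S : finType)
    (G : (S -> R) -> S -> R) (t : R) (f : S -> R) (x : S) : R :=
  limn (series (fun j : nat => t ^+ j / j`!%:R * iter j G f x)).

(* The entry (G 1_{y})(x) of the generator: the jump rate x -> y when x != y. *)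
Definition rate (R : realType) (S : finType)
    (G : (S -> R) -> S -> R) (x y : S) : R :=
  G (fun z => (z == y)%:R) x.

Definition is_measure (R : realType) (S : finType) (m : S -> R) : Prop :=
  forall x, 0 <= m x.

Definition is_probability (R : realType) (S : finType) (m : S -> R) : Prop :=
  is_measure m /\ \sum_x m x = 1.

Definition concentrated_on (R : realType) (S : finType) (m : S -> R)
    (A : {set S}) : Prop :=
  forall x, x \notin A -> m x = 0.

Definition detailed_balance (R : realType) (S : finType)
    (G : (S -> R) -> S -> R) (m : S -> R) : Prop :=
  forall x y, m x * rate G x y = m y * rate G y x.

Definition invariant_measure (R : realType) (S : finType)
    (G : (S -> R) -> S -> R) (m : S -> R) : Prop :=
  forall t : R, 0 <= t -> forall f : S -> R,
    \sum_x m x * semigroup G t f x = \sum_x m x * f x.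

(** * Lattice and configurations *)

(* L = L^+ - L^- + 1; only meaningful when Lm <= Lp. *)
Definition nsites (Lm Lp : int) : nat := absz (Lp - Lm + 1).

Definition lattice (Lm Lp : int) : seq int :=
  [seq Lm + i%:Z | i <- iota 0 (nsites Lm Lp)].

Lemma mem_lattice (Lm Lp k : int) :
  Lm <= Lp -> (k \in lattice Lm Lp) = (Lm <= k <= Lp).
Proof.
move=> Hle; have HL : (nsites Lm Lp)%:Z = Lp - Lm + 1.
  by rewrite /nsites gez0_abs // addr_ge0 // subr_ge0.
apply/mapP/andP => [[i] | [Hk1 Hk2]].
  rewrite mem_iota add0n /= => Hi ->; split; first by rewrite lerDl.
  by rewrite -lerBrDl -ltzD1 -HL.
have Hk : (absz (k - Lm))%:Z = k - Lm by rewrite gez0_abs // subr_ge0.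
exists (absz (k - Lm)); last by rewrite Hk addrC subrK.
by rewrite mem_iota add0n /= -ltz_nat Hk HL ltzD1 lerD2r.
Qed.

Definition site (Lm Lp : int) : finType := seq_sub (lattice Lm Lp).

Definition config (n : nat) (Lm Lp : int) : finType :=
  {ffun site Lm Lp -> 'I_n.+1}.

Definition swap (n : nat) (Lm Lp : int) (k l : site Lm Lp)
    (eta : config n Lm Lp) : config n Lm Lp :=
  [ffun j => eta (if j == k then l else if j == l then k else j)].

(* sgn(eta_k - eta_l), the difference being taken in [int] *)
Definition sgn_diff (n : nat) (Lm Lp : int) (eta : config n Lm Lp)
    (k l : site Lm Lp) : int :=
  sgz ((eta k : nat)%:Z - (eta l : nat)%:Z).

(** * The n-priority ASEP *)

(* The inner sum has exactly one term, l = k + 1, when k < L^+, and is empty for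
   k = L^+. *)
Definition asep (R : realType) (n : nat) (w q : R) (Lm Lp : int)
    (f : config n Lm Lp -> R) (eta : config n Lm Lp) : R :=
  \sum_(k : site Lm Lp) \sum_(l : site Lm Lp | val l == val k + 1)
    w * (q ^ sgn_diff eta k l - (eta k == eta l)%:R)
      * (f (swap k l eta) - f eta).
Arguments asep {R} n w q Lm Lp f eta.

Definition energy (n : nat) (Lm Lp : int) (eta : config n Lm Lp) : int :=
  - \sum_(k : site Lm Lp) \sum_(l : site Lm Lp | val l < val k)
      sgn_diff eta k l.

Definition pi_rev (R : realType) (n : nat) (q : R) (Lm Lp : int)
    (eta : config n Lm Lp) : R :=
  q ^ (- energy eta).
Arguments pi_rev {R} n q Lm Lp eta.

(** * Particle numbers

A vector (N^1, ..., N^n) is a function on ['I_n]; the index [i : 'I_n] stands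
for the species alpha = i + 1, which is [lift ord0 i : 'I_n.+1]. *)

Definition pnum (n : nat) (Lm Lp : int) (a : 'I_n.+1)
    (eta : config n Lm Lp) : nat :=
  (\sum_(k : site Lm Lp) (eta k == a))%N.

Definition proj (R : realType) (n : nat) (Lm Lp : int) (N : 'I_n -> nat)
    (eta : config n Lm Lp) : R :=
  \prod_(i < n) (pnum (lift ord0 i) eta == N i)%:R.

Definition sector (n : nat) (Lm Lp : int) (N : 'I_n -> nat) :
    {set config n Lm Lp} :=
  [set eta | [forall i : 'I_n, pnum (lift ord0 i) eta == N i]].

(* (N^0, N^1, ..., N^n) with N^0 = L - sum_(alpha >= 1) N^alpha; the subtraction
   is truncated, so this is only meaningful when the sum is at most L. *)
Definition occupation (n L : nat) (N : 'I_n -> nat) (a : 'I_n.+1) : nat :=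
  if unlift ord0 a is Some i then N i else (L - \sum_(i < n) N i)%N.

(** * q-numbers and partition functions *)

Definition qnum (R : realType) (q : R) (c : nat) : R :=
  if q == 1 then c%:R else (q ^+ c - q ^- c) / (q - q^-1).

Definition qfact (R : realType) (q : R) (m : nat) : R :=
  \prod_(1 <= j < m.+1) qnum q j.

Definition canon_Z (R : realType) (q : R) (n L : nat) (N : 'I_n -> nat) : R :=
  qfact q L / \prod_(a < n.+1) qfact q (occupation L N a).

Definition pi_canon (R : realType) (n : nat) (q : R) (Lm Lp : int)
    (N : 'I_n -> nat) (eta : config n Lm Lp) : R :=
  pi_rev n q Lm Lp eta * proj R N eta / canon_Z q (nsites Lm Lp) N.
Arguments pi_canon {R n} q Lm Lp N eta.

(* Entries in ['I_L.+1] lose nothing: sum_alpha N^alpha <= L bounds each of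
   them by L. *)
Definition grand_Z (R : realType) (q : R) (n L : nat) (mu : 'I_n -> R) : R :=
  \sum_(N : {ffun 'I_n -> 'I_L.+1} | (\sum_(i < n) N i <= L)%N)
    expR (\sum_(i < n) mu i * (N i : nat)%:R)
      * canon_Z q L (fun i => N i : nat).

Definition pi_grand (R : realType) (n : nat) (q : R) (Lm Lp : int)
    (mu : 'I_n -> R) (eta : config n Lm Lp) : R :=
  expR (\sum_(i < n) mu i * (pnum (lift ord0 i) eta)%:R)
    / grand_Z q (nsites Lm Lp) mu * pi_rev n q Lm Lp eta.
Arguments pi_grand {R n} q Lm Lp mu eta.

(* Main.v *)
(** A measure m is invariant under e^{tG} iff sum_x m(x) (G f)(x) = 0 for all f:
the power series in t with coefficients sum_x m(x) (G^j f)(x) / j! is constant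
iff its linear coefficients all vanish.

Crossing an adjacent pair changes -E by 2 sgn(eta_k - eta_{k+1}), so pi times
the jump rate across a bond is invariant under the swap of that bond.  This is
detailed balance; it also makes pi times any function of the particle numbers
stationary.  Conversely, if pi h is stationary, testing against h makes the
Dirichlet form of h vanish, so h is invariant under adjacent swaps, hence
constant on each sector.

The normalization is the q-multinomial formula for the sum of q^{-E} over the
words of given content, by induction on the length: removing the first letter
a gives the factor q^{sum_{b > a} N^b - sum_{b < a} N^b}, and these factors
times [N^a] add up to [L]. *)

Require Import Defs.
From mathcomp Require Import all_boot all_order all_algebra.
From mathcomp Require Import all_classical all_reals all_analysis.
From mathcomp Require Import perm.
From mathcomp Require Import ring zify.

Set Implicit Arguments.
Unset Strict Implicit.
Unset Printing Implicit Defensive.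

Import Order.TTheory GRing.Theory Num.Theory.
Import numFieldNormedType.Exports.
Local Open Scope ring_scope.

(** * Invariance and generators *)

(** A bound on [G] in the sup norm: iterates then grow at most like [C ^+ j], so the exponential
    series converges. *)
Definition bounded_generator (R : realType) (S : finType)
    (G : (S -> R) -> S -> R) (C : R) : Prop :=
  forall (f : S -> R) (M : R), (forall x, `|f x| <= M) ->
    forall x, `|G f x| <= C * M.

Lemma fun_bounded (R : realType) (S : finType) (f : S -> R) :
  {M : R | 0 <= M & forall x, `|f x| <= M}.
Proof.
exists (\sum_y `|f y|) => [|x]; first exact: sumr_ge0.
by rewrite (bigD1 x) //= lerDl sumr_ge0.
Qed.

Lemma iter_bounded (R : realType) (S : finType) (G : (S -> R) -> S -> R)
    (C M : R) (f : S -> R) (j : nat) :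
  bounded_generator G C -> (forall x, `|f x| <= M) ->
  forall x, `|iter j G f x| <= C ^+ j * M.
Proof.
move=> GC fM; elim: j => [|j IH] x; first by rewrite expr0 mul1r.
by rewrite iterS exprS -mulrA; apply: GC.
Qed.

Lemma series_exp_le (R : realType) (C : R) (n : nat) :
  0 <= C -> \sum_(0 <= j < n) C ^+ j / j`!%:R <= expR C.
Proof.
move=> C0; have := @nondecreasing_cvgn_le R (series (exp_coeff C)) _ _ n.
apply; last exact: is_cvg_series_exp_coeff.
by apply: nondecreasing_series => j _ _; rewrite /exp_coeff divr_ge0 ?exprn_ge0.
Qed.

(** As [S] is finite, the pairing with [m] can be taken term by term, which reduces invariance to a
    question about one scalar power series in [t]. *)
Lemma semigroup_pairing_cvg (R : realType) (S : finType)
    (G : (S -> R) -> S -> R) (C t : R) (m f : S -> R) :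
  0 <= C -> bounded_generator G C -> 0 <= t ->
  (series (fun j : nat => t ^+ j / j`!%:R * \sum_x m x * iter j G f x)
    @ \oo --> \sum_x m x * semigroup G t f x)%classic.
Proof.
move=> C0 GC t0; have [M M0 fM] := fun_bounded f.
have cv x : (series (fun j : nat => t ^+ j / j`!%:R * iter j G f x)
             @ \oo --> semigroup G t f x)%classic.
  (* Absolute convergence, by comparison with [M] times the series of [expR (t * C)]. *)
  apply: normed_cvg.
  apply: (@series_le_cvg _ _ (M *: exp_coeff (t * C))) => [j|j|j|] //=.
  - by rewrite /= /exp_coeff mulr_ge0 // divr_ge0 // exprn_ge0 // mulr_ge0.
  - rewrite /GRing.scale /= /exp_coeff /= normrM ger0_norm; last first.
      by rewrite divr_ge0 // exprn_ge0.
    rewrite [leRHS](_ : _ = t ^+ j / j`!%:R * (C ^+ j * M)); last first.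
      by rewrite /GRing.scale /= exprMn; ring.
    by rewrite ler_wpM2l ?divr_ge0 ?exprn_ge0 //; apply: iter_bounded.
  - exact/is_cvg_seriesZ/is_cvg_series_exp_coeff.
rewrite (_ : series _ = fun k => \sum_x m x *
    series (fun j : nat => t ^+ j / j`!%:R * iter j G f x) k); last first.
  apply/funext => k; rewrite /series /=.
  under [RHS]eq_bigr => x _ do rewrite mulr_sumr.
  rewrite exchange_big /=; apply: eq_bigr => j _.
  by rewrite mulr_sumr; apply: eq_bigr => x _; ring.
apply: cvg_big => [|x _]; first exact: add_continuous.
by apply: cvgM; [exact: cvg_cst | exact: cv].
Qed.

Lemma invariant_measureP (R : realType) (S : finType)
    (G : (S -> R) -> S -> R) (C : R) (m : S -> R) :
  0 <= C -> bounded_generator G C ->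
  invariant_measure G m <-> (forall f, \sum_x m x * G f x = 0).
Proof.
move=> C0 GC; split=> [inv f | m0 t t0 f]; last first.
  have cv := @semigroup_pairing_cvg R S G C t m f C0 GC t0.
  rewrite -(cvg_lim _ cv) //; apply: cvg_lim => //.
  (* The shift discards the empty partial sum; every later one equals the coefficient of order 0. *)
  rewrite -cvg_shiftS /=.
  apply: cvg_near_cst; apply: nearW => k.
  rewrite /series /= big_nat_recl // [X in _ + X]big1 ?addr0 => [|j _]; last first.
    by rewrite (m0 (iter j G f)) mulr0.
  by rewrite expr0 fact0 invr1 !mul1r.
set a := fun j => \sum_x m x * iter j G f x.
have [M M0 fM] := fun_bounded f.
pose K := (\sum_x `|m x|) * M.
have K0 : 0 <= K by rewrite mulr_ge0 // sumr_ge0.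
have aK j : `|a j| <= K * C ^+ j.
  apply: (le_trans (ler_norm_sum _ _ _)).
  rewrite /K -mulrA mulr_suml; apply: ler_sum => x _.
  by rewrite normrM ler_wpM2l // mulrC iter_bounded.
(* Comparing the power series in t with its constant value a_0 bounds the
   linear coefficient by O(t). *)
have small (t : R) : 0 < t -> t <= 1 -> `|a 1| <= t * (K * expR C).
  move=> t0 t1.
  have cv := @semigroup_pairing_cvg R S G C t m f C0 GC (ltW t0).
  rewrite (inv _ (ltW t0)) in cv.
  (* The shift by 2 guarantees that the terms of order 0 and 1 are present and cancel; by invariance
     the series tends to [a 0]. *)
  have cvN : ((fun k => `|series (fun j => t ^+ j / j`!%:R * a j) (k + 2)%N
                          - a 0 - t * a 1|)
      @ \oo --> `|a 0 - a 0 - t * a 1|)%classic.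
    apply: cvg_norm; apply: cvgB; last exact: cvg_cst.
    by apply: cvgB; [rewrite cvg_shiftn|exact: cvg_cst].
  rewrite subrr sub0r normrN normrM gtr0_norm // in cvN.
  rewrite -(ler_pM2l t0).
  apply: (cvgr_to_le cvN).
  apply: nearW => k; rewrite addn2 /series /= big_ltn // big_ltn //.
  rewrite expr0 factS fact0 muln1 invr1 !mul1r expr1 mulr1.
  rewrite (_ : _ + _ - _ - _ = \sum_(2 <= j < k.+2) t ^+ j / j`!%:R * a j);
    last by ring.
  apply: (le_trans (ler_norm_sum _ _ _)).
  (* Since [t <= 1], each power from the second on is at most [t ^+ 2], leaving part of the series
     of [expR C]. *)
  apply: (@le_trans _ _ (\sum_(2 <= j < k.+2) t ^+ 2 * K * (C ^+ j / j`!%:R))).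
    rewrite big_nat [leRHS]big_nat; apply: ler_sum => j /andP[j2 _].
    rewrite normrM ger0_norm; last by rewrite divr_ge0 // exprn_ge0 // ltW.
    rewrite [leRHS](_ : _ = t ^+ 2 / j`!%:R * (K * C ^+ j)); last by ring.
    apply: ler_pM => //; first by rewrite divr_ge0 // exprn_ge0 // ltW.
    by rewrite ler_wpM2r // ler_wiXn2l // ltW.
  rewrite -mulr_sumr [leRHS](_ : _ = t ^+ 2 * K * expR C); last by ring.
  apply: ler_wpM2l; first exact: mulr_ge0 (sqr_ge0 t) K0.
  apply: (le_trans _ (series_exp_le k.+2 C0)).
  rewrite [leRHS](@big_cat_nat _ _ _ 2) //= lerDr sumr_ge0 // => j _.
  by rewrite divr_ge0 // exprn_ge0.
apply/eqP; rewrite -normr_le0; apply/ler_addgt0Pr => e e0; rewrite add0r.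
have KC : 0 <= K * expR C by rewrite mulr_ge0 // expR_ge0.
(* This [t] makes the bound in [small] at most [e]; the added 1 keeps the denominator positive when
   [K] is 0. *)
pose t := Num.min 1 (e / (K * expR C + 1)).
have t0 : 0 < t by rewrite lt_min ltr01 divr_gt0 // ltr_wpDl.
apply: (le_trans (small t t0 _)); first by rewrite ge_min lexx.
apply: (@le_trans _ _ (t * (K * expR C + 1))).
  by rewrite ler_wpM2l ?lerDl // ltW.
by rewrite -ler_pdivlMr ?ge_min ?lexx ?orbT // ltr_wpDl.
Qed.

(** * Detailed balance and the Dirichlet form *)

Definition jump_rate (R : realType) (n : nat) (w q : R) (Lm Lp : int)
    (k l : site Lm Lp) (x : config n Lm Lp) : R :=
  w * (q ^ sgn_diff x k l - (x k == x l)%:R).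

Lemma asepE (R : realType) (n : nat) (w q : R) (Lm Lp : int)
    (f : config n Lm Lp -> R) (x : config n Lm Lp) :
  asep n w q Lm Lp f x =
  \sum_(k : site Lm Lp) \sum_(l : site Lm Lp | val l == val k + 1)
    jump_rate w q k l x * (f (swap k l x) - f x).
Proof. by []. Qed.

(** The constant dominates twice the total jump rate out of any configuration, the 2 coming from the
    difference of two values of [f]. *)
Lemma asep_bounded (R : realType) (n : nat) (w q : R) (Lm Lp : int) :
  {C : R | 0 <= C & bounded_generator (asep n w q Lm Lp) C}.
Proof.
pose c (x : config n Lm Lp) : R :=
  \sum_(k : site Lm Lp) \sum_(l : site Lm Lp | val l == val k + 1)
    `|jump_rate w q k l x| * 2.
have [C C0 cC] := fun_bounded c; exists C => // f M fM x.
have M0 : 0 <= M := le_trans (normr_ge0 _) (fM x).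
apply: (@le_trans _ _ (c x * M)); last first.
  by rewrite ler_wpM2r // (le_trans (ler_norm _)).
rewrite asepE mulr_suml; apply: (le_trans (ler_norm_sum _ _ _)).
apply: ler_sum => k _; rewrite mulr_suml.
apply: (le_trans (ler_norm_sum _ _ _)); apply: ler_sum => l _.
rewrite normrM -mulrA ler_wpM2l // (le_trans (ler_normB _ _)) //.
by rewrite mulr_natl mulr2n lerD.
Qed.

Lemma swapE (n : nat) (Lm Lp : int) (k l : site Lm Lp) (x : config n Lm Lp) j :
  swap k l x j = x (tperm k l j).
Proof.
rewrite ffunE; case: tpermP => [->|->|/eqP/negPf-> /eqP/negPf->] //.
  by rewrite eqxx.
by case: eqP => [->|_] //; rewrite eqxx.
Qed.

Lemma swapK (n : nat) (Lm Lp : int) (k l : site Lm Lp) :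
  involutive (@swap n Lm Lp k l).
Proof. by move=> x; apply/ffunP => j; rewrite !swapE tpermK. Qed.

Lemma sgn_diffN (n : nat) (Lm Lp : int) (x : config n Lm Lp) k l :
  sgn_diff x l k = - sgn_diff x k l.
Proof. by rewrite /sgn_diff -sgzN opprB. Qed.

Lemma sgn_diff_swap (n : nat) (Lm Lp : int) (k l : site Lm Lp)
    (x : config n Lm Lp) i j :
  sgn_diff (swap k l x) i j = sgn_diff x (tperm k l i) (tperm k l j).
Proof. by rewrite /sgn_diff !swapE. Qed.

(* An adjacent transposition preserves the order of every pair of sites but
   the transposed one. *)
Lemma energy_swap (n : nat) (Lm Lp : int) (k l : site Lm Lp)
    (x : config n Lm Lp) : val l == val k + 1 ->
  - energy (swap k l x) = - energy x + sgn_diff x k l *+ 2.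
Proof.
move=> /eqP kl; have lk : l != k.
  by apply/eqP => lk; move: kl; rewrite lk; lia.
rewrite /energy !opprK !pair_big_dep /=.
rewrite (reindex_inj
  (h := fun p => (tperm k l p.1, tperm k l p.2))) /=; last first.
  by move=> [a b] [c d] [/perm_inj -> /perm_inj ->].
(* After the reindexing the exchanged bond appears as [(k, l)] on the left and [(l, k)] on the
   right; all other pairs match. *)
rewrite [LHS](bigD1 (k, l)) /=; last by rewrite tpermL tpermR kl ltzD1.
rewrite [in RHS](bigD1 (l, k)) /=; last by rewrite kl; rewrite ltzD1.
rewrite sgn_diff_swap !tpermK (sgn_diffN x k l) [RHS]addrAC mulr2n addKr.
congr (_ + _); apply: eq_big => [[a b]|[a b] _] /=; last first.
  by rewrite sgn_diff_swap !tpermK.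
have E (c : site Lm Lp) : ssval c = val c by [].
have V (c d : site Lm Lp) : (c == d) = (val c == val d) by [].
rewrite !xpair_eqE !E.
case: tpermP => [->|->|/eqP + /eqP +]; case: tpermP => [->|->|/eqP + /eqP +];
  rewrite !V kl; lia.
Qed.

Lemma pi_rev_gt0 (R : realType) (n : nat) (q : R) (Lm Lp : int)
    (x : config n Lm Lp) : 0 < q -> 0 < pi_rev n q Lm Lp x.
Proof. by move=> q0; rewrite exprz_gt0. Qed.

(** With [s] the sign across the bond, the swap multiplies [pi_rev] by [q ^ (2 s)] and turns the
    rate factor [q ^ s] into [q ^ (- s)]; for equal values nothing changes. *)
Lemma pi_rev_jump_swap (R : realType) (n : nat) (w q : R) (Lm Lp : int)
    (k l : site Lm Lp) (x : config n Lm Lp) : 0 < q -> val l == val k + 1 ->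
  pi_rev n q Lm Lp (swap k l x) * jump_rate w q k l (swap k l x) =
  pi_rev n q Lm Lp x * jump_rate w q k l x.
Proof.
move=> q0 kl; rewrite /pi_rev energy_swap // /jump_rate sgn_diff_swap.
rewrite !swapE tpermL tpermR sgn_diffN mulrCA [RHS]mulrCA eq_sym; congr (_ * _).
have [xkl|_] := eqVneq; last first.
  by rewrite !subr0 -!expfzDr ?gt_eqF //; congr (q ^ _); ring.
by rewrite /sgn_diff xkl subrr sgz0 mul0rn oppr0 !addr0.
Qed.

Lemma jump_rate_ge0 (R : realType) (n : nat) (w q : R) (Lm Lp : int)
    (k l : site Lm Lp) (x : config n Lm Lp) : 0 <= w -> 0 < q ->
  0 <= jump_rate w q k l x.
Proof.
move=> w0 q0; apply: mulr_ge0 => //; have [xkl|_] := eqVneq.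
  by rewrite /sgn_diff xkl subrr sgz0 expr0z subrr.
by rewrite subr0 exprz_ge0 // ltW.
Qed.

Lemma jump_rate_gt0 (R : realType) (n : nat) (w q : R) (Lm Lp : int)
    (k l : site Lm Lp) (x : config n Lm Lp) : 0 < w -> 0 < q -> x k != x l ->
  0 < jump_rate w q k l x.
Proof.
by move=> w0 q0 /negPf xkl; rewrite /jump_rate xkl subr0 mulr_gt0 // exprz_gt0.
Qed.

Lemma swap_id (n : nat) (Lm Lp : int) (k l : site Lm Lp) (x : config n Lm Lp) :
  x k = x l -> swap k l x = x.
Proof.
by move=> xkl; apply/ffunP => j; rewrite swapE; case: tpermP => [->|->|].
Qed.

Lemma sum_swap (V : nmodType) (n : nat) (Lm Lp : int) (k l : site Lm Lp)
    (f : config n Lm Lp -> V) : \sum_x f x = \sum_x f (swap k l x).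
Proof. exact: (reindex_inj (inv_inj (@swapK n Lm Lp k l))). Qed.

(** Gain and loss cancel on each bond: the swap is a change of variables that exchanges them and
    preserves both [g] and [pi_rev] times the rate. *)
Lemma asep_stationary (R : realType) (n : nat) (w q : R) (Lm Lp : int)
    (g f : config n Lm Lp -> R) : 0 < q ->
  (forall k l x, g (swap k l x) = g x) ->
  \sum_x pi_rev n q Lm Lp x * g x * asep n w q Lm Lp f x = 0.
Proof.
move=> q0 gs; under eq_bigr => x _ do rewrite asepE mulr_sumr.
rewrite exchange_big big1 //= => k _.
under eq_bigr => x _ do rewrite mulr_sumr.
rewrite exchange_big big1 //= => l kl.
under eq_bigr => x _ do rewrite mulrBr mulrBr.
rewrite sumrB; apply/eqP; rewrite subr_eq0; apply/eqP.
rewrite [RHS](sum_swap k l); apply: eq_bigr => x _.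
by rewrite gs; ring: (pi_rev_jump_swap w x q0 kl).
Qed.

(** Balance holds bond by bond: off the diagonal, a bond contributes to either side only if its
    swap, an involution, exchanges [x] and [y]. *)
Lemma detailed_balance_asep (R : realType) (n : nat) (w q : R) (Lm Lp : int) :
  0 < q -> detailed_balance (asep n w q Lm Lp) (pi_rev n q Lm Lp).
Proof.
move=> q0 x y; have [->//|xy] := eqVneq x y.
rewrite /rate !asepE !mulr_sumr; apply: eq_bigr => k _.
rewrite !mulr_sumr; apply: eq_bigr => l kl.
rewrite (negPf xy) [y == x]eq_sym (negPf xy) !subr0.
have [sx|sx] := eqVneq (swap k l x) y.
  by rewrite -sx swapK eqxx !mulr1 pi_rev_jump_swap.
rewrite -(inj_eq (inv_inj (@swapK n Lm Lp k l))).
by rewrite swapK eq_sym (negPf sx) !mulr0.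
Qed.

(* Dirichlet form: testing the invariance of pi h against h itself gives
   sum_x pi(x) c_{k,l}(x) (h(x^{kl}) - h(x))^2 = 0. *)
Lemma stationary_swap (R : realType) (n : nat) (w q : R) (Lm Lp : int)
    (h : config n Lm Lp -> R) : 0 < w -> 0 < q ->
  (forall f, \sum_x pi_rev n q Lm Lp x * h x * asep n w q Lm Lp f x = 0) ->
  forall k l, val l == val k + 1 -> forall x, h (swap k l x) = h x.
Proof.
move=> w0 q0 h0 k l kl x.
(* With equal values the rate vanishes and the Dirichlet form says nothing, but the swap fixes
   [x]. *)
have [xkl|xkl] := eqVneq (x k) (x l); first by rewrite swap_id.
pose u k l x := pi_rev n q Lm Lp x * jump_rate w q k l x.
pose D k l x := u k l x * (h (swap k l x) - h x) ^+ 2.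
have D0 k' l' x' : 0 <= D k' l' x'.
  apply: mulr_ge0 (mulr_ge0 _ _) (sqr_ge0 _); first exact/ltW/pi_rev_gt0.
  exact: jump_rate_ge0 (ltW w0) q0.
have HD : \sum_k \sum_(l | val l == val k + 1) \sum_x D k l x = 0.
  suff E : - (\sum_k \sum_(l | val l == val k + 1) \sum_x D k l x) =
      2 * \sum_x pi_rev n q Lm Lp x * h x * asep n w q Lm Lp h x.
    by apply/eqP; rewrite -oppr_eq0 E h0 mulr0.
  rewrite mulr_sumr.
  under [RHS]eq_bigr => z _ do rewrite asepE !mulr_sumr.
  rewrite [RHS]exchange_big -sumrN; apply: eq_bigr => a _ /=.
  under [RHS]eq_bigr => z _ do rewrite !mulr_sumr.
  rewrite [RHS]exchange_big -sumrN; apply: eq_bigr => b ab /=.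
  (* Of the two copies, one is reindexed by the swap, which preserves [u a b]; together they form
     minus a square. *)
  have -> : \sum_z 2 * (pi_rev n q Lm Lp z * h z *
        (jump_rate w q a b z * (h (swap a b z) - h z))) =
      \sum_z u a b z * h z * (h (swap a b z) - h z) +
      \sum_z u a b z * h (swap a b z) * (h z - h (swap a b z)).
    rewrite [X in _ + X](sum_swap a b) -big_split /=; apply: eq_bigr => z _.
    by rewrite swapK /u pi_rev_jump_swap //; ring.
  by rewrite -big_split -sumrN; apply: eq_bigr => z _; rewrite /D /=; ring.
(* All terms are nonnegative, so the vanishing total forces each single term to vanish. *)
have HDk := psumr_eq0P
  (fun k _ => sumr_ge0 _ (fun l _ => sumr_ge0 _ (fun x _ => D0 k l x))) HD.
have HDl := psumr_eq0P (fun l _ => sumr_ge0 _ (fun x _ => D0 k l x)) (HDk k isT).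
have HDx := psumr_eq0P (fun x _ => D0 k l x) (HDl l kl).
have /eqP := HDx x isT.
rewrite mulf_eq0 sqrf_eq0 subr_eq0 mulf_eq0.
rewrite (gt_eqF (pi_rev_gt0 x q0)) (gt_eqF (jump_rate_gt0 w0 q0 xkl)).
by move=> /eqP.
Qed.

(** * q-multinomial coefficients *)

Lemma qnum0 (R : realType) (q : R) : qnum q 0 = 0.
Proof. by rewrite /qnum; case: ifP => // _; rewrite expr0 invr1 subrr mul0r. Qed.

Lemma qnum_gt0 (R : realType) (q : R) (c : nat) :
  1 <= q -> (0 < c)%N -> 0 < qnum q c.
Proof.
move=> q1 c0; rewrite /qnum; case: eqP => [_|/eqP qn1]; first by rewrite ltr0n.
have {qn1 q1} q1 : 1 < q by rewrite lt_neqAle eq_sym qn1.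
have q0 : 0 < q := lt_trans ltr01 q1.
rewrite divr_gt0 // subr_gt0.
  by rewrite (@lt_trans _ _ 1) ?invf_lt1 ?exprn_gt0 // exprn_egt1 // -lt0n.
by rewrite (@lt_trans _ _ 1) ?invf_lt1.
Qed.

Lemma qfact_gt0 (R : realType) (q : R) (m : nat) : 1 <= q -> 0 < qfact q m.
Proof.
move=> q1; rewrite /qfact big_nat prodr_gt0 // => j /andP[j0 _].
exact: qnum_gt0.
Qed.

Lemma qfact0 (R : realType) (q : R) : qfact q 0 = 1.
Proof. by rewrite /qfact big_geq. Qed.

Lemma qfactS (R : realType) (q : R) (m : nat) :
  qfact q m.+1 = qnum q m.+1 * qfact q m.
Proof. by rewrite /qfact big_nat_recr //= mulrC. Qed.

(** The two-species case of [qnum_sum], and the engine of its induction. *)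
Lemma qnumD (R : realType) (q : R) (a b : nat) : q != 0 ->
  qnum q (a + b) = q ^ b%:Z * qnum q a + q ^ (- a%:Z) * qnum q b.
Proof.
move=> q0; rewrite /qnum; case: eqP => [->|_].
  by rewrite !exp1rz !mul1r natrD.
rewrite -exprnN -exprnP !mulrA -mulrDl; congr (_ / _).
rewrite !exprD.
have qa : q ^+ a != 0 by rewrite expf_neq0.
have qb : q ^+ b != 0 by rewrite expf_neq0.
by field; apply/andP.
Qed.

Lemma qnum_sum (R : realType) (q : R) (m : nat) (N : 'I_m -> nat) : q != 0 ->
  qnum q (\sum_a N a) =
  \sum_(a < m) q ^ (\sum_(b < m) sgz ((b : nat)%:Z - (a : nat)%:Z) * (N b)%:Z)
    * qnum q (N a).
Proof.
move=> q0; elim: m N => [|m IH] N; first by rewrite !big_ord0 qnum0.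
(* Species 0 is below all others: its exponent is the sum of their numbers, and each of them picks
   up [- N 0]. *)
rewrite !big_ord_recl /= qnumD //; congr (_ + _).
  congr (q ^ _ * _); rewrite subrr sgz0 mul0r add0r.
  rewrite (big_morph Posz PoszD (erefl _)); apply: eq_bigr => b _.
  by rewrite subr0 gtr0_sgz ?mul1r.
rewrite IH mulr_sumr; apply: eq_bigr => a _.
rewrite mulrA -expfzDr // big_ord_recl; congr (q ^ (_ + _) * _).
  by rewrite sub0r sgzN gtr0_sgz // mulN1r.
apply: eq_bigr => b _; congr (sgz _ * _).
by rewrite /= /bump !leq0n; lia.
Qed.

(** Increasing pairs minus decreasing pairs of a word, which is [- energy]; the recursion on the
    first letter suits the induction in [q_multinomial]. *)
Fixpoint disorder (m : nat) (s : seq 'I_m) : int :=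
  if s is a :: s' then
    \sum_(b <- s') sgz ((b : nat)%:Z - (a : nat)%:Z) + disorder s'
  else 0.

Lemma disorderE (m L : nat) (t : L.-tuple 'I_m) :
  \sum_(i < L) \sum_(j < L | (j < i)%N)
    sgz ((tnth t i : nat)%:Z - (tnth t j : nat)%:Z) = disorder t.
Proof.
(* Reading letters as naturals supplies a default for [nth], since ['I_m] may be empty. *)
pose D (s : seq 'I_m) : int := \sum_(i < size s) \sum_(j < i)
  sgz ((nth 0%N (map val s) i)%:Z - (nth 0%N (map val s) j)%:Z).
have DE s : D s = disorder s.
  elim: s => [|a s IH]; first by rewrite /D big_ord0.
  rewrite /D [size _]/= big_ord_recl big_ord0 add0r.
  under eq_bigr => i _ do rewrite lift0 big_ord_recl /=.
  rewrite big_split /= -IH; congr (_ + _).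
  by rewrite (big_nth a) big_mkord; apply: eq_bigr => i _; rewrite (nth_map a).
rewrite -DE /D size_tuple; apply: eq_bigr => i _.
rewrite (big_ord_widen L (fun j => sgz ((nth 0%N (map val t) i)%:Z -
  (nth 0%N (map val t) j)%:Z)) (ltnW (ltn_ord i))).
apply: eq_bigr => j _.
by rewrite !(nth_map (tnth t i)) ?size_tuple // -!tnth_nth.
Qed.

Lemma sum_seq_count (V : nmodType) (T : finType) (s : seq T) (F : T -> V) :
  \sum_(x <- s) F x = \sum_x F x *+ count_mem x s.
Proof.
elim: s => [|a s IH]; first by rewrite big_nil big1.
rewrite big_cons IH /=; under [RHS]eq_bigr => x _ do rewrite mulrnDr.
rewrite big_split /=; congr (_ + _).
rewrite (bigD1 a) //= eqxx mulr1n big1 ?addr0 // => x xa.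
by rewrite eq_sym (negPf xa).
Qed.

Lemma sum_tuple_cons (V : nmodType) (T : finType) (L : nat)
    (P : pred (seq T)) (F : seq T -> V) :
  \sum_(t : L.+1.-tuple T | P t) F t =
  \sum_(a : T) \sum_(t : L.-tuple T | P (a :: t)) F (a :: t).
Proof.
rewrite pair_big_dep /=.
rewrite (reindex (fun p : T * L.-tuple T => [tuple of p.1 :: p.2])) //=.
exists (fun t => (thead t, [tuple of behead t])) => [[a t] _|t _] /=.
  by rewrite theadE; congr pair; apply: val_inj.
by apply: val_inj; case/tupleP: t => a t; rewrite /= theadE.
Qed.

(** The q-factorials stand on the left as factors so that the induction never divides by them. *)
Lemma q_multinomial (R : realType) (q : R) (m L : nat) (N : 'I_m -> nat) :
  q != 0 -> (\sum_a N a)%N = L ->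
  (\sum_(t : L.-tuple 'I_m | [forall a, count_mem a t == N a])
    q ^ disorder t) * \prod_a qfact q (N a) = qfact q L.
Proof.
move=> q0; elim: L N => [|L IH] N NL.
  have N0 a : N a = 0%N.
    by apply/eqP; move/eqP: NL; rewrite sum_nat_eq0 => /forallP/(_ a).
  rewrite [X in _ * X]big1 => [|a _]; last by rewrite N0 qfact0.
  rewrite mulr1 qfact0 (big_pred1 [tuple]) /= ?expr0z // => t.
  by rewrite (tuple0 t) /=; apply/forallP => a; rewrite N0.
rewrite (sum_tuple_cons _ (fun s => [forall a, count_mem a s == N a])
  (fun s => q ^ disorder s)).
rewrite qfactS -NL qnum_sum // !mulr_suml; apply: eq_bigr => a _.
(* If [a] does not occur, no word begins with it, matching [[0] = 0]. *)
case Na: (N a) => [|c].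
  rewrite qnum0 mulr0 mul0r [X in X * _]big_pred0 ?mul0r // => t.
  by apply/forallP => /(_ a); rewrite /= eqxx Na.
pose N' b := (N b - (b == a))%N.
have NN' b : N b = ((b == a) + N' b)%N.
  by rewrite subnKC //; case: eqP => [->|//]; rewrite Na.
have N'L : (\sum_b N' b)%N = L.
  apply/eqP; rewrite -(eqn_add2l 1) [X in _ == X]add1n -NL.
  under [X in _ == X]eq_bigr => b _ do rewrite NN'.
  rewrite big_split /= [X in _ == (X + _)%N](bigD1 a) //= eqxx.
  by rewrite [X in (_ + X + _)%N]big1 // => b /negPf ->.
have -> : \prod_b qfact q (N b) = qnum q c.+1 * \prod_b qfact q (N' b).
  rewrite (bigD1 a) //= [in RHS](bigD1 a) //= mulrA; congr (_ * _).
    by rewrite /N' eqxx Na subn1 -qfactS.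
  by apply: eq_bigr => b /negPf ba; rewrite /N' ba subn0.
rewrite -(IH N' N'L).
set e := (X in q ^ X).
have -> : \sum_(t : L.-tuple 'I_m | [forall b, count_mem b (a :: t) == N b])
      q ^ disorder (a :: t) =
    q ^ e * \sum_(t : L.-tuple 'I_m | [forall b, count_mem b t == N' b])
      q ^ disorder t.
  rewrite mulr_sumr; apply: eq_big => [t|t /forallP tN].
    by apply: eq_forallb => b; rewrite NN' [b == a]eq_sym /= eqn_add2l.
  rewrite -expfzDr //=; congr (q ^ (_ + _)).
  rewrite sum_seq_count; apply: eq_bigr => b _.
  have /eqP <- := tN b; rewrite /= -mulr_natr natz.
  (* Removing the first letter changes only the count of [a], whose sign in the exponent is 0. *)
  by have [->|_] := eqVneq a b; rewrite ?subrr ?sgz0 ?mul0r ?add0n.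
by ring.
Qed.

(** * Configurations as words *)

Lemma size_lattice (Lm Lp : int) : size (lattice Lm Lp) = nsites Lm Lp.
Proof. by rewrite size_map size_iota. Qed.

Lemma site_at_subproof (Lm Lp : int) (i : 'I_(nsites Lm Lp)) :
  Lm + i%:Z \in lattice Lm Lp.
Proof. by apply: map_f; rewrite mem_iota /= add0n ltn_ord. Qed.

Definition site_at (Lm Lp : int) (i : 'I_(nsites Lm Lp)) : site Lm Lp :=
  SeqSub (site_at_subproof i).

Lemma position_subproof (Lm Lp : int) (k : site Lm Lp) :
  (index (val k) (lattice Lm Lp) < nsites Lm Lp)%N.
Proof. by rewrite -size_lattice index_mem; exact: ssvalP. Qed.

Definition position (Lm Lp : int) (k : site Lm Lp) : 'I_(nsites Lm Lp) :=
  Ordinal (position_subproof k).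

Lemma positionK (Lm Lp : int) : cancel (@position Lm Lp) (@site_at Lm Lp).
Proof.
move=> k; apply: val_inj => /=.
rewrite -[RHS](nth_index 0 (ssvalP k)) (nth_map 0%N) ?size_iota ?position_subproof //.
by rewrite nth_iota ?position_subproof.
Qed.

Lemma site_atK (Lm Lp : int) : cancel (@site_at Lm Lp) (@position Lm Lp).
Proof.
move=> i; apply: val_inj; have /(congr1 val) /= := positionK (site_at i).
by move=> /addrI [].
Qed.

Lemma site_at_bij (Lm Lp : int) : bijective (@site_at Lm Lp).
Proof. by exists (@position Lm Lp); [apply: site_atK|apply: positionK]. Qed.

Definition word (n : nat) (Lm Lp : int) (x : config n Lm Lp) :
    (nsites Lm Lp).-tuple 'I_n.+1 := [tuple x (site_at i) | i < nsites Lm Lp].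

(** Taking a bare sequence, with default [ord0], lets words be cut and rearranged without carrying
    size proofs. *)
Definition of_word (n : nat) (Lm Lp : int) (s : seq 'I_n.+1) : config n Lm Lp :=
  [ffun k => nth ord0 s (position k)].

Lemma wordK (n : nat) (Lm Lp : int) :
  cancel (@word n Lm Lp) (fun t => of_word Lm Lp t).
Proof.
by move=> x; apply/ffunP => k; rewrite ffunE -tnth_nth tnth_mktuple positionK.
Qed.

Lemma of_wordK (n : nat) (Lm Lp : int) :
  cancel (fun t : (nsites Lm Lp).-tuple 'I_n.+1 => of_word Lm Lp t)
    (@word n Lm Lp).
Proof.
by move=> t; apply: eq_from_tnth => i; rewrite tnth_mktuple ffunE site_atK -tnth_nth.
Qed.

Lemma word_bij (n : nat) (Lm Lp : int) : bijective (@word n Lm Lp).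
Proof. exact: Bijective (@wordK n Lm Lp) (@of_wordK n Lm Lp). Qed.

Lemma energy_word (n : nat) (Lm Lp : int) (x : config n Lm Lp) :
  - energy x = disorder (word x).
Proof.
rewrite -disorderE /energy opprK.
rewrite (reindex (@site_at Lm Lp)) /=; last exact/onW_bij/site_at_bij.
apply: eq_bigr => i _.
rewrite (reindex (@site_at Lm Lp)) /=; last exact/onW_bij/site_at_bij.
apply: eq_big => j; first by rewrite ltrD2l ltz_nat.
by rewrite !tnth_mktuple.
Qed.

Lemma pnum_word (n : nat) (Lm Lp : int) (a : 'I_n.+1) (x : config n Lm Lp) :
  pnum a x = count_mem a (word x).
Proof.
rewrite /pnum (reindex (@site_at Lm Lp)) /=; last exact/onW_bij/site_at_bij.
by rewrite -sum1_count big_map [RHS]big_mkcond big_enum; apply: eq_bigr.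
Qed.

Lemma sum_pnum (n : nat) (Lm Lp : int) (x : config n Lm Lp) :
  (\sum_(a < n.+1) pnum a x)%N = nsites Lm Lp.
Proof.
under eq_bigr => a _ do rewrite pnum_word.
rewrite -[RHS](size_tuple (word x)) -sum1_size (sum_seq_count _ (fun=> 1%N)).
by apply: eq_bigr => a _; rewrite [RHS]natn.
Qed.

Lemma sum_occupation (n L : nat) (N : 'I_n -> nat) : (\sum_(i < n) N i <= L)%N ->
  (\sum_(a < n.+1) occupation L N a)%N = L.
Proof.
move=> NL; rewrite big_ord_recl /occupation unlift_none.
rewrite [X in (_ + X)%N](eq_bigr N) => [|i _]; last by rewrite liftK.
by rewrite subnK.
Qed.

(** The count of species 0 is forced, since all counts add up to the number of sites. *)
Lemma sector_word (n : nat) (Lm Lp : int) (N : 'I_n -> nat)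
    (x : config n Lm Lp) :
  (\sum_(i < n) N i <= nsites Lm Lp)%N ->
  (x \in sector Lm Lp N) =
  [forall a, count_mem a (word x) == occupation (nsites Lm Lp) N a].
Proof.
move=> NL; rewrite inE; apply/forallP/forallP => xN a; last first.
  by rewrite pnum_word (eqP (xN _)) /occupation liftK.
rewrite -pnum_word; case: (unliftP ord0 a) => [i|] ->.
  by rewrite (eqP (xN i)) /occupation liftK.
rewrite /occupation unlift_none; have := sum_pnum x.
rewrite big_ord_recl (eq_bigr N) => [<-|i _]; first by rewrite addnK.
exact/eqP.
Qed.

Lemma sum_sector_pi_rev (R : realType) (n : nat) (q : R) (Lm Lp : int)
    (N : 'I_n -> nat) : 1 <= q -> (\sum_(i < n) N i <= nsites Lm Lp)%N ->
  \sum_(x in sector Lm Lp N) pi_rev n q Lm Lp x = canon_Z q (nsites Lm Lp) N.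
Proof.
move=> q1 NL; have q0 : q != 0 by rewrite gt_eqF // (lt_le_trans ltr01).
rewrite /canon_Z -(q_multinomial q0 (sum_occupation NL)) mulfK; last first.
  by rewrite gt_eqF // prodr_gt0 // => a _; exact: qfact_gt0.
rewrite [RHS](reindex (@word n Lm Lp)) /=; last exact/onW_bij/word_bij.
by apply: eq_big => [x|x _]; [exact: sector_word|rewrite /pi_rev energy_word].
Qed.

Lemma canon_Z_gt0 (R : realType) (q : R) (n L : nat) (N : 'I_n -> nat) :
  1 <= q -> 0 < canon_Z q L N.
Proof.
move=> q1; rewrite /canon_Z divr_gt0 ?qfact_gt0 // prodr_gt0 // => a _.
exact: qfact_gt0.
Qed.

(** Sorting by adjacent exchanges: the first letter of [s] is found in [t] and carried to the front,
    then the tails are compared behind a longer common prefix [p]. *)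
Lemma perm_eq_adjacent (T : eqType) (U : Type) (h : seq T -> U) (L : nat) :
  (forall s1 a b s2, size (s1 ++ a :: b :: s2) = L ->
    h (s1 ++ a :: b :: s2) = h (s1 ++ b :: a :: s2)) ->
  forall s t, size s = L -> perm_eq s t -> h s = h t.
Proof.
move=> hs.
have move_front p a u v : size (p ++ a :: u ++ v) = L ->
    h (p ++ a :: u ++ v) = h (p ++ u ++ a :: v).
  elim: u p => [//|b u IH] p sz /=.
  rewrite hs // -cat_rcons IH ?cat_rcons //.
  by move: sz; rewrite !size_cat /= size_cat.
suff H s t p : size (p ++ s) = L -> perm_eq s t -> h (p ++ s) = h (p ++ t).
  by move=> s t; apply: (H s t [::]).
elim: s t p => [|a s IH] t p sz; first by move/perm_size/esym/size0nil ->.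
move=> st; have : a \in t by rewrite -(perm_mem st) mem_head.
move=> ta; case/splitPr: ta st => u v.
rewrite perm_sym perm_catC /= perm_cons perm_catC perm_sym => st.
rewrite -move_front -?cat_rcons; first by apply: IH; rewrite ?cat_rcons.
by rewrite -sz cat_rcons !size_cat /= (perm_size st) size_cat.
Qed.


Lemma swap_of_word (n : nat) (Lm Lp : int) (s1 s2 : seq 'I_n.+1)
    (a b : 'I_n.+1) : size (s1 ++ a :: b :: s2) = nsites Lm Lp ->
  exists k l : site Lm Lp, val l == val k + 1 /\
    of_word Lm Lp (s1 ++ b :: a :: s2) =
    swap k l (of_word Lm Lp (s1 ++ a :: b :: s2)).
Proof.
rewrite size_cat /= => sz.
have i1 : (size s1 < nsites Lm Lp)%N by rewrite -sz; lia.
have i2 : ((size s1).+1 < nsites Lm Lp)%N by rewrite -sz; lia.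
exists (site_at (Ordinal i1)), (site_at (Ordinal i2)); split.
  by rewrite /=; apply/eqP; lia.
apply/ffunP => k; rewrite swapE !ffunE.
case: tpermP => [->|->|k1 k2]; rewrite ?site_atK /= !nth_cat.
- by rewrite !ltnNge leqnn leqnSn subnn subSnn.
- by rewrite !ltnNge leqnn leqnSn subnn subSnn.
have pos_neq (i : 'I_(nsites Lm Lp)) : k <> site_at i -> position k != i :> nat.
  by move=> ki; apply/eqP => /val_inj ik; apply: ki; rewrite -ik positionK.
have := pos_neq _ k1; have := pos_neq _ k2; rewrite /=.
(* Beyond [s1], offsets 0 and 1 are the two excluded sites; from offset 2 on both words read
   [s2]. *)
case: ltnP => //; case E: (_ - _)%N => [|[|j]] //=; lia.
Qed.

(** Irreducibility within a sector: its configurations have words of equal content, hence are linked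
    by adjacent swaps. *)
Lemma swap_invariant_sector (R : Type) (n : nat) (Lm Lp : int)
    (N : 'I_n -> nat) (h : config n Lm Lp -> R) :
  (\sum_(i < n) N i <= nsites Lm Lp)%N ->
  (forall k l, val l == val k + 1 -> forall x, h (swap k l x) = h x) ->
  {in sector Lm Lp N &, forall x y, h x = h y}.
Proof.
move=> NL hs x y; rewrite !sector_word // => /forallP xN /forallP yN.
rewrite -(wordK x) -(wordK y).
apply: (perm_eq_adjacent (h := fun s => h (of_word Lm Lp s)) (L := nsites Lm Lp)).
- move=> s1 a b s2 sz; have [k [l [kl ->]]] := swap_of_word sz.
  by rewrite hs.
- by rewrite size_tuple.
- by apply/allP => a _ /=; rewrite (eqP (xN a)) eq_sym.
Qed.

(** * Canonical and grand-canonical measures *)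

Lemma projE (R : realType) (n : nat) (Lm Lp : int) (N : 'I_n -> nat)
    (x : config n Lm Lp) : Defs.proj R N x = (x \in sector Lm Lp N)%:R.
Proof.
have [|] := boolP (x \in sector Lm Lp N); rewrite inE.
  move=> /forallP xN.
  by rewrite /Defs.proj big1 // => i _; rewrite xN.
rewrite negb_forall => /existsP[i /negPf xi].
by rewrite /Defs.proj (bigD1 i) //= xi mul0r.
Qed.

Lemma pnum_swap (n : nat) (Lm Lp : int) (a : 'I_n.+1) (k l : site Lm Lp)
    (x : config n Lm Lp) : pnum a (swap k l x) = pnum a x.
Proof.
rewrite /pnum [RHS](reindex_inj (@perm_inj _ (tperm k l))) /=.
by apply: eq_bigr => j _; rewrite swapE.
Qed.

(** Serves both ensembles, each being [pi_rev] times a function of the particle numbers. *)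
Lemma asep_invariant (R : realType) (n : nat) (w q : R) (Lm Lp : int)
    (g : config n Lm Lp -> R) : 0 < q ->
  (forall k l x, g (swap k l x) = g x) ->
  invariant_measure (asep n w q Lm Lp) (fun x => pi_rev n q Lm Lp x * g x).
Proof.
move=> q0 gs; have [C C0 GC] := asep_bounded n w q Lm Lp.
by apply/(invariant_measureP _ C0 GC) => f; apply: asep_stationary.
Qed.

Lemma pi_canon_probability (R : realType) (n : nat) (q : R) (Lm Lp : int)
    (N : 'I_n -> nat) : 1 <= q -> (\sum_(i < n) N i <= nsites Lm Lp)%N ->
  is_probability (pi_canon q Lm Lp N).
Proof.
move=> q1 NL; have q0 : 0 < q := lt_le_trans ltr01 q1; split=> [x|].
  by rewrite /pi_canon projE !mulr_ge0 ?invr_ge0 // ltW ?pi_rev_gt0 ?canon_Z_gt0.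
rewrite -mulr_suml; under eq_bigr => x _ do rewrite projE mulr_natr mulrb.
by rewrite -big_mkcond sum_sector_pi_rev // divff // gt_eqF // canon_Z_gt0.
Qed.

Lemma pi_canon_unique (R : realType) (n : nat) (w q : R) (Lm Lp : int)
    (N : 'I_n -> nat) (nu : config n Lm Lp -> R) :
  0 < w -> 1 <= q -> (\sum_(i < n) N i <= nsites Lm Lp)%N ->
  is_probability nu -> concentrated_on nu (sector Lm Lp N) ->
  invariant_measure (asep n w q Lm Lp) nu -> nu =1 pi_canon q Lm Lp N.
Proof.
move=> w0 q1 NL [nu0 nu1] nuN; have q0 : 0 < q := lt_le_trans ltr01 q1.
have [C C0 GC] := asep_bounded n w q Lm Lp.
move=> /(invariant_measureP _ C0 GC) inv.
(* The density with respect to [pi_rev], to which the Dirichlet form argument applies. *)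
pose h x := nu x / pi_rev n q Lm Lp x.
have hE x : nu x = pi_rev n q Lm Lp x * h x.
  by rewrite mulrC divfK // gt_eqF // pi_rev_gt0.
have hs : forall k l, val l == val k + 1 -> forall x, h (swap k l x) = h x.
  by apply: (stationary_swap w0 q0) => f; under eq_bigr => x _ do rewrite -hE.
have hN := swap_invariant_sector NL hs.
move=> x; rewrite /pi_canon projE.
have [xN|xN] := boolP (x \in _); last by rewrite nuN // mulr0 mul0r.
(* The density is constant on the sector, and total mass 1 fixes the constant. *)
have : h x * canon_Z q (nsites Lm Lp) N = 1.
  rewrite -sum_sector_pi_rev // mulr_sumr -nu1
    [RHS](bigID (mem (sector Lm Lp N))) /=.
  rewrite [X in _ = _ + X]big1 ?addr0 => [|y yN]; last exact: nuN.
  by apply: eq_bigr => y yN; rewrite hE (hN x y) // mulrC.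
have Z0 : canon_Z q (nsites Lm Lp) N != 0 by rewrite gt_eqF // canon_Z_gt0.
by move=> /(canRL (mulfK Z0)) hx; rewrite hE hx mulr1 mul1r.
Qed.

Lemma sum_grand (R : realType) (n : nat) (q : R) (Lm Lp : int)
    (mu : 'I_n -> R) : 1 <= q ->
  \sum_(x : config n Lm Lp)
    expR (\sum_(i < n) mu i * (pnum (lift ord0 i) x)%:R) * pi_rev n q Lm Lp x =
  grand_Z q (nsites Lm Lp) mu.
Proof.
move=> q1; set L := nsites Lm Lp.
pose P (N : {ffun 'I_n -> 'I_L.+1}) := (\sum_(i < n) N i <= L)%N.
(* [inord] does not truncate here, because no species exceeds the number of sites; the sum is then
   split by the value of [num]. *)
pose num (x : config n Lm Lp) : {ffun 'I_n -> 'I_L.+1} :=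
  [ffun i => inord (pnum (lift ord0 i) x)].
have numE x i : num x i = pnum (lift ord0 i) x :> nat.
  rewrite ffunE inordK // ltnS /L -(sum_pnum x) (bigD1 (lift ord0 i)) //=.
  exact: leq_addr.
rewrite (partition_big num P) /=; last first.
  move=> x _; rewrite /P; under eq_bigr => i _ do rewrite numE.
  by rewrite /L -(sum_pnum x) big_ord_recl leq_addl.
apply: eq_bigr => N NL; rewrite -sum_sector_pi_rev // mulr_sumr.
apply: eq_big => [x|x /eqP <-].
  rewrite inE; apply/eqP/forallP => [<- i|xN]; first by rewrite numE.
  by apply/ffunP => i; apply: val_inj; rewrite /= numE (eqP (xN i)).
by congr (expR _ * _); apply: eq_bigr => i _; rewrite numE.
Qed.

Lemma grand_Z_gt0 (R : realType) (q : R) (n L : nat) (mu : 'I_n -> R) :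
  1 <= q -> 0 < grand_Z q L mu.
Proof.
(* The zero vector is always admissible and contributes a positive term. *)
move=> q1; rewrite /grand_Z (bigD1 [ffun=> ord0]) /=; last first.
  by rewrite big1 // => i _; rewrite ffunE.
apply: ltr_pwDl; first by rewrite mulr_gt0 ?expR_gt0 ?canon_Z_gt0.
apply: sumr_ge0 => N _.
by rewrite mulr_ge0 ?expR_ge0 // ltW // canon_Z_gt0.
Qed.

Unset Implicit Arguments.

Theorem theorem3p1 (R : realType) (n : nat) (w q : R) (Lm Lp : int)
    (hn : (1 <= n)%N) (hw : 0 < w) (hq : 1 <= q)
    (hL : 2 <= Lp - Lm + 1) :
  let G := asep n w q Lm Lp in
  (is_measure (pi_rev n q Lm Lp) /\
   detailed_balance G (pi_rev n q Lm Lp))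
  /\
  (forall N : 'I_n -> nat, (\sum_(i < n) N i <= nsites Lm Lp)%N ->
    is_probability (pi_canon q Lm Lp N) /\
    concentrated_on (pi_canon q Lm Lp N) (sector Lm Lp N) /\
    invariant_measure G (pi_canon q Lm Lp N) /\
    (forall nu : config n Lm Lp -> R,
       is_probability nu -> concentrated_on nu (sector Lm Lp N) ->
       invariant_measure G nu -> nu =1 pi_canon q Lm Lp N))
  /\
  (forall mu : 'I_n -> R,
    is_probability (pi_grand q Lm Lp mu) /\
    invariant_measure G (pi_grand q Lm Lp mu)).
Proof.
have q0 : 0 < q := lt_le_trans ltr01 hq.
move=> G; split; [split|split].
- by move=> x; rewrite ltW // pi_rev_gt0.
- exact: detailed_balance_asep.
- move=> N NL; split; first exact: pi_canon_probability.
  split; first by move=> x /negPf xN; rewrite /pi_canon projE xN mulr0 mul0r.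
  split; last by move=> nu; exact: pi_canon_unique.
  have -> : pi_canon q Lm Lp N = fun x => pi_rev n q Lm Lp x *
      (Defs.proj R N x / canon_Z q (nsites Lm Lp) N).
    by apply/funext => x; rewrite mulrA.
  apply: asep_invariant => // k l x; congr (_ / _).
  by apply: eq_bigr => i _; rewrite pnum_swap.
move=> mu; have Z0 := grand_Z_gt0 (nsites Lm Lp) mu hq.
split; [split|].
- by move=> x; rewrite /pi_grand !mulr_ge0 ?invr_ge0 ?expR_ge0 // ltW // pi_rev_gt0.
- rewrite /pi_grand; under eq_bigr => x _ do rewrite mulrAC.
  by rewrite -mulr_suml sum_grand // divff // gt_eqF.
have -> : pi_grand q Lm Lp mu = fun x => pi_rev n q Lm Lp x *
    (expR (\sum_(i < n) mu i * (pnum (lift ord0 i) x)%:R)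
      / grand_Z q (nsites Lm Lp) mu).
  by apply/funext => x; rewrite mulrC.
apply: asep_invariant => // k l x; congr (expR _ / _).
by apply: eq_bigr => i _; rewrite pnum_swap.
Qed.
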